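(* Let $N\ge1$, $h=(b-a)/N$, and let $\chi_N=(x_0,\dots,x_N)$, $x_i=a+ih$, be the uniform partition of $[a,b]$. Let $C$ be a constant and let $\phi:[a,b]\times\mathbb R_+\to\mathbb R_+$ be a continuous function, non-decreasing in its second argument, with $\phi(x,0)=0$ for all $x$. Let $A_N(f,x)=\sum_{i=0}^N c_i(x)f(x_i)$, with $c_i:[a,b]\to\mathbb R$, be a linear operator such that for every $s\in\mathcal S_{\chi_N}$ and every $x\in[a,b]$ $$|A_N(s,x)-s(x)|\le C\,\phi\big(x,\omega_{[a,b]}(s,h)\big).$$ Then for every continuous set-valued function $F:[a,b]\to K(\mathbb R^n)$ and every $x\in[a,b]$, $$\mathrm{haus}\big(A^M_N(F,x),F(x)\big)\le 2\,\omega_{[a,b]}(F,h)+C\,\phi\big(x,4\,\omega_{[a,b]}(F,h)\big).$$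
   Context: $\mathbb R_+=[0,\infty)$. $K(\mathbb R^n)$ is the collection of all nonempty compact subsets of $\mathbb R^n$, $|\cdot|$ is the Euclidean norm, $\mathrm{dist}(a,B)=\inf_{b\in B}|a-b|$, and $\mathrm{haus}(A,B)=\max\{\sup_{a\in A}\mathrm{dist}(a,B),\sup_{b\in B}\mathrm{dist}(b,A)\}$ is the Hausdorff distance; continuity of $F$ is with respect to it. $\Pi_B(a)=\{b\in B:|a-b|=\mathrm{dist}(a,B)\}$ is the set of projections of $a$ on $B$. For $f:[a,b]\to X$ with values in a metric space $(X,\rho)$ (Euclidean distance for $X=\mathbb R^n$, Hausdorff distance for $X=K(\mathbb R^n)$), the modulus of continuity is $\omega_{[a,b]}(f,\delta)=\sup\{\rho(f(x),f(y)):|x-y|\le\delta,\ x,y\in[a,b]\}$, $\delta>0$. $\mathcal S_{\chi_N}$ is the set of continuous piecewise linear functions $s:[a,b]\to\mathbb R^n$ with knots at $\chi_N$ (i.e. affine on each $[x_i,x_{i+1}]$). The operator $A_N$ is applied to $\mathbb R^n$-valued functions by the same formula. A metric chain of a finite sequence of compact sets $\{A_0,\dots,A_N\}$ is a vector $(a_0,\dots,a_N)$ with $a_i\in A_i$ for all $i$, for which there is $j$, $0\le j\le N$, such that $a_{i-1}\in\Pi_{A_{i-1}}(a_i)$ for $1\le i\le j$ and $a_{i+1}\in\Pi_{A_{i+1}}(a_i)$ for $j\le i\le N-1$. $CH(A_0,\dots,A_N)$ denotes the set of all metric chains. The metric linear combination with coefficients $\lambda_0,\dots,\lambda_N\in\mathbb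 R$ is $$\bigoplus_{i=0}^N\lambda_iA_i=\Big\{\sum_{i=0}^N\lambda_ia_i:(a_0,\dots,a_N)\in CH(A_0,\dots,A_N)\Big\}.$$ The metric analogue of $A_N$ is the operator on set-valued functions $A^M_N(F,x)=\bigoplus_{i=0}^N c_i(x)F(x_i)$. *)

(* Defs.v *)
From HB Require Import structures.
From mathcomp Require Import all_boot all_order all_algebra.
From mathcomp Require Import all_classical all_reals all_analysis.

Set Implicit Arguments.
Unset Strict Implicit.
Unset Printing Implicit Defensive.

Import Order.TTheory GRing.Theory Num.Theory.
Import numFieldNormedType.Exports.

Local Open Scope classical_set_scope.
Local Open Scope ring_scope.

(* The library's norm on ['rV[R]_n] is the max norm, hence the definition of
   [eucl_norm].  The library's topology on ['rV[R]_n] is the product topology, which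
   is the Euclidean one, so its [compact] and [continuous] are used as they are.
   [sup] and [inf] are real-valued (0 when the supremum or infimum does not
   exist in [R]). *)

Section Euclid.
Variables (R : realType) (n : nat).
Implicit Types (u v : 'rV[R]_n) (A B : set 'rV[R]_n).

Definition eucl_norm u : R := Num.sqrt (\sum_(k < n) u ord0 k ^+ 2).

Definition eucl_dist u v : R := eucl_norm (u - v).

Definition dist_set u B : R := inf [set eucl_dist u v | v in B].

Definition haus A B : R :=
  Num.max (sup [set dist_set u B | u in A]) (sup [set dist_set v A | v in B]).

Definition proj_set B u : set 'rV[R]_n :=
  [set v | B v /\ eucl_dist u v = dist_set u B].

Definition nonempty_compact A : Prop := A !=set0 /\ compact A.

Definition haus_continuous (a b : R) (F : R -> set 'rV[R]_n) : Prop :=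
  forall x, x \in `[a, b] -> forall e : R, 0 < e ->
    exists2 d : R, 0 < d &
      forall y, y \in `[a, b] -> `|x - y| < d -> haus (F x) (F y) < e.

(* [i] and [k] range over consecutive indices, [k = i + 1]. *)
Definition metric_chain (N : nat) (A : 'I_N.+1 -> set 'rV[R]_n)
    (v : 'I_N.+1 -> 'rV[R]_n) : Prop :=
  (forall i, A i (v i)) /\
  exists j : 'I_N.+1, forall i k : 'I_N.+1, k = i.+1 :> nat ->
    ((k <= j)%N -> proj_set (A i) (v k) (v i)) /\
    ((j <= i)%N -> proj_set (A k) (v i) (v k)).

Definition metric_lincomb (N : nat) (lam : 'I_N.+1 -> R)
    (A : 'I_N.+1 -> set 'rV[R]_n) : set 'rV[R]_n :=
  [set \sum_(i < N.+1) lam i *: v i | v in metric_chain A].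

End Euclid.

Definition modulus (R : realType) (X : Type) (rho : X -> X -> R) (a b : R)
    (f : R -> X) (delta : R) : R :=
  sup [set r | exists x y : R, [/\ x \in `[a, b], y \in `[a, b],
                                   `|x - y| <= delta & r = rho (f x) (f y)]].

Section Sampling.
Variables (R : realType) (n N : nat) (a b : R).

Definition step : R := (b - a) / N%:R.

Definition node (i : nat) : R := a + i%:R * step.

Definition spline (s : R -> 'rV[R]_n) : Prop :=
  {within `[a, b], continuous s} /\
  forall i : 'I_N, exists u v : 'rV[R]_n,
    forall x, x \in `[node i, node i.+1] -> s x = u + x *: v.

Definition sample_op (c : 'I_N.+1 -> R -> R) (f : R -> 'rV[R]_n) (x : R) :
    'rV[R]_n :=
  \sum_(i < N.+1) c i x *: f (node i).

Definition metric_sample_op (c : 'I_N.+1 -> R -> R)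
    (F : R -> set 'rV[R]_n) (x : R) : set 'rV[R]_n :=
  metric_lincomb (fun i => c i x) (fun i => F (node i)).

End Sampling.

Arguments step {R} N a b.
Arguments node {R} N a b i.
Arguments spline {R n} N a b s.
Arguments sample_op {R n N} a b c f x.
Arguments metric_sample_op {R n N} a b c F x.

(* Main.v *)
Require Import Defs.
From HB Require Import structures.
From mathcomp Require Import all_boot all_order all_algebra.
From mathcomp Require Import all_classical all_reals all_analysis.
From mathcomp Require Import ring lra.

Import Order.TTheory GRing.Theory Num.Theory.
Import numFieldNormedType.Exports.

Local Open Scope classical_set_scope.
Local Open Scope ring_scope.

(** A metric chain [v] of the samples [F (node i)] is interpolated by a
piecewise linear function [s].  Consecutive entries of a chain are mutual
projections in at least one direction, so they lie within the Hausdorff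
distance of neighbouring samples, hence within [w := modulus haus a b F h]
([metric_chain_haus]).  In the coordinate [t = (x - a) / h] the interpolant is
therefore [w]-Lipschitz ([polyline_lipschitz]), so its own modulus at [h] is
at most [w] and it stays within [w] of [v i] at distance at most [h] from
node [i].  Since [s] takes the values [v i] at the nodes, the sampling operator
applied to [s] gives exactly the point [\sum_k c k x *: v k] of the metric
operator, and the assumed error bound places this point within
[w + C * phi x (4 * w)] of [v i].

Now fix [x] and a node [i] with [`|x - node i| <= h], so that [F x] and
[F (node i)] are [w]-close.  Every point of the metric operator comes from a
chain whose entry [v i] is within [w] of [F x].  Conversely a point [y] of
[F x] projects onto some [p] of [F (node i)] within [w], and a chain passes
through [p] ([metric_chain_through]).  Either way one more [w] is added, which
gives the estimate.

Two points need care.  The real-valued supremum defining [w] bounds its members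
only because the values [haus (F x) (F y)] are bounded; this follows from the
continuity of [x |-> haus (F a) (F x)] ([haus_continuous_bounded]).  And [C] may
be negative, so that enlarging the argument of [phi] does not obviously enlarge
[C * phi]; but then the assumed error bound forces [phi] to vanish at the
modulus of every spline, and linear splines have arbitrarily large modulus
([error_bound_monotone]), unless the dimension is [0] and all moduli vanish. *)

(** * Euclidean and Hausdorff distances *)

Lemma sum_continuous {T : topologicalType} {R : numFieldType}
    {V : normedModType R} (M : nat) (f : 'I_M -> T -> V) :
  (forall i, continuous (f i)) -> continuous (fun x => \sum_(i < M) f i x).
Proof.
move=> fc x; apply: (cvg_big _ (nbhs_filter x)) => [|i _].
  exact: add_continuous.
exact: fc.
Qed.

Section Euclid.
Context {R : realType} {n : nat}.
Implicit Types (u v w : 'rV[R]_n) (A B D : set 'rV[R]_n) (r t : R).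

Lemma eucl_norm_ge0 u : 0 <= eucl_norm u.
Proof. exact: sqrtr_ge0. Qed.

Lemma sqr_eucl_norm u : eucl_norm u ^+ 2 = \sum_(k < n) u ord0 k ^+ 2.
Proof. by rewrite sqr_sqrtr// sumr_ge0// => k _; exact: sqr_ge0. Qed.

Lemma eucl_normZ t u : eucl_norm (t *: u) = `|t| * eucl_norm u.
Proof.
rewrite /eucl_norm -sqrtr_sqr -sqrtrM ?sqr_ge0// mulr_sumr.
by congr Num.sqrt; apply: eq_bigr => k _; rewrite mxE exprMn.
Qed.

(** For [p], [q] the norms of [u], [v] and [S] their inner product, the sum of
squares [\sum_k (x * u k - y * v k)^2] is a quadratic form in [(x, y)]; its value
at [(q, p)] is [2 * (p * q) * (p * q - S)]. *)
Lemma cauchy_schwarz u v :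
  \sum_(k < n) u ord0 k * v ord0 k <= eucl_norm u * eucl_norm v.
Proof.
have := eucl_norm_ge0 u; have := eucl_norm_ge0 v.
have := sqr_eucl_norm u; have := sqr_eucl_norm v.
set p := eucl_norm u; set q := eucl_norm v; set S := \sum_(k < n) _ * _.
move=> qE pE q0 p0.
have quad (x y : R) : 0 <= x ^+ 2 * p ^+ 2 - 2 * (x * y) * S + y ^+ 2 * q ^+ 2.
  have -> : x ^+ 2 * p ^+ 2 - 2 * (x * y) * S + y ^+ 2 * q ^+ 2
          = \sum_(k < n) (x * u ord0 k - y * v ord0 k) ^+ 2.
    rewrite pE qE !mulr_sumr -sumrN -!big_split /=.
    by apply: eq_bigr => k _; ring.
  by apply: sumr_ge0 => k _; exact: sqr_ge0.
have [S0|S0] := leP S 0; first by apply: le_trans S0 _; exact: mulr_ge0.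
have [pq0|pq0] := eqVneq (p * q) 0.
  (* a large multiple of a null vector forces [S = 0] *)
  have := quad (q * q + 1) S; have := quad S (p * p + 1).
  move/eqP: pq0; rewrite mulf_eq0 => /orP[]/eqP ->; nra.
have pq_gt0 : 0 < p * q by rewrite lt0r pq0 mulr_ge0.
have := quad q p; nra.
Qed.

Lemma eucl_normD u v : eucl_norm (u + v) <= eucl_norm u + eucl_norm v.
Proof.
rewrite -(@ler_pXn2r _ 2) ?nnegrE ?addr_ge0 ?eucl_norm_ge0//.
have -> : eucl_norm (u + v) ^+ 2 = eucl_norm u ^+ 2 + eucl_norm v ^+ 2
    + 2 * \sum_(k < n) u ord0 k * v ord0 k.
  rewrite !sqr_eucl_norm mulr_sumr -!big_split /=.
  by apply: eq_bigr => k _; rewrite mxE; ring.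
by have := cauchy_schwarz u v; nra.
Qed.

Lemma eucl_norm0 : eucl_norm (0 : 'rV[R]_n) = 0.
Proof. by rewrite -(scale0r 0) eucl_normZ normr0 mul0r. Qed.

Lemma eucl_dist_ge0 u v : 0 <= eucl_dist u v.
Proof. exact: eucl_norm_ge0. Qed.

Lemma eucl_distxx u : eucl_dist u u = 0.
Proof. by rewrite /eucl_dist subrr eucl_norm0. Qed.

Lemma eucl_distC u v : eucl_dist u v = eucl_dist v u.
Proof.
by rewrite /eucl_dist -opprB -scaleN1r eucl_normZ normrN normr1 mul1r.
Qed.

Lemma eucl_distD v u w : eucl_dist u w <= eucl_dist u v + eucl_dist v w.
Proof. by rewrite /eucl_dist -(subrKA v) eucl_normD. Qed.

Lemma eucl_dist_continuous u : continuous (eucl_dist u).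
Proof.
have sum_sqr : continuous (fun v => \sum_(k < n) (u - v) ord0 k ^+ 2).
  apply: (sum_continuous (V := R^o)) => k.
  have uk : continuous (fun v => (u - v) ord0 k).
    under eq_fun do rewrite !mxE.
    move=> v; apply: (@continuousB _ R^o); last exact: coord_continuous.
    exact: cst_continuous.
  by move=> v; exact: (continuous_comp (uk v) (@exprn_continuous R 2 _)).
by move=> v; exact: (continuous_comp (sum_sqr v) (@sqrt_continuous R _)).
Qed.

Lemma dist_set_le {B u v} : B v -> dist_set u B <= eucl_dist u v.
Proof.
move=> Bv; apply: ge_inf; last by exists v.
by exists 0 => _ [w _ <-]; exact: eucl_dist_ge0.
Qed.

Lemma proj_set_nonempty {B} u : nonempty_compact B -> proj_set B u !=set0.
Proof.
case=> B0 cB.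
have [v /set_mem Bv vmin] := EVT_min_rV B0 cB
  (continuous_subspaceT (@eucl_dist_continuous u)).
exists v; split=> //; apply/eqP; rewrite eq_le dist_set_le// andbT.
apply: lb_le_inf; first by exists (eucl_dist u v), v.
by move=> _ [w Bw <-]; apply: vmin; exact: mem_set.
Qed.

Lemma dist_setD {B} u v : nonempty_compact B ->
  dist_set u B <= eucl_dist u v + dist_set v B.
Proof.
move=> /(proj_set_nonempty v) [w [Bw <-]].
exact: le_trans (dist_set_le Bw) (eucl_distD _ _ _).
Qed.

Lemma hausC A B : haus A B = haus B A.
Proof. by rewrite /haus maxC. Qed.

Lemma haus_le {A B r} : A !=set0 -> B !=set0 ->
  (forall u, A u -> dist_set u B <= r) ->
  (forall v, B v -> dist_set v A <= r) -> haus A B <= r.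
Proof.
move=> A0 B0 AB BA; rewrite /haus ge_max.
by apply/andP; split; apply: ge_sup => [|_ [u Au <-]];
  [exact: image_nonempty|exact: AB|exact: image_nonempty|exact: BA].
Qed.

(** The supremum in [haus] bounds its members because [A], being compact, lies in
a ball around any point of [B]. *)
Lemma dist_set_le_haus {A B u} : nonempty_compact A -> nonempty_compact B ->
  A u -> dist_set u B <= haus A B.
Proof.
move=> [A0 cA] [[v Bv] _] Au; rewrite /haus le_max; apply/orP; left.
have [w _ wmax] := EVT_max_rV A0 cA
  (continuous_subspaceT (@eucl_dist_continuous v)).
apply: ub_le_sup; last by exists u.
exists (eucl_dist v w) => _ [z Az <-].
by apply: le_trans (dist_set_le Bv) _; rewrite eucl_distC wmax// mem_set.
Qed.

Lemma haus_ge0 {A B} : nonempty_compact A -> nonempty_compact B -> 0 <= haus A B.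
Proof.
move=> hA hB; have [[u Au] _] := hA.
apply: le_trans (dist_set_le_haus hA hB Au).
by apply: lb_le_inf => [|_ [v _ <-]];
  [exact: (image_nonempty _ hB.1)|exact: eucl_dist_ge0].
Qed.

Lemma hausD {B A D} : nonempty_compact A -> nonempty_compact B ->
  nonempty_compact D -> haus A D <= haus A B + haus B D.
Proof.
suff main A' D' u : nonempty_compact A' -> nonempty_compact B ->
    nonempty_compact D' -> A' u -> dist_set u D' <= haus A' B + haus B D'.
  move=> hA hB hD; apply: (haus_le hA.1 hD.1) => u ?; first exact: main.
  by rewrite addrC (hausC B D) (hausC A B); exact: main.
move=> hA hB hD Au; have [v [Bv uv]] := proj_set_nonempty u hB.
apply: le_trans (dist_setD u v hD) _.
by rewrite uv lerD// dist_set_le_haus.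
Qed.

End Euclid.

Lemma eucl_norm_sum {R : realType} {n M : nat} (u : 'I_M -> 'rV[R]_n) :
  eucl_norm (\sum_(i < M) u i) <= \sum_(i < M) eucl_norm (u i).
Proof.
elim/big_ind2: _ => [|x1 x2 y1 y2 h1 h2|//]; first by rewrite eucl_norm0.
exact: le_trans (eucl_normD _ _) (lerD h1 h2).
Qed.

(** * Moduli of continuity *)

Section Modulus.
Context {R : realType} {X : Type} {rho : X -> X -> R} {a b : R} {f : R -> X}.
Context {delta : R}.

Lemma modulus_le {M : R} : a <= b -> 0 <= delta ->
  (forall x y, x \in `[a, b] -> y \in `[a, b] -> `|x - y| <= delta ->
     rho (f x) (f y) <= M) ->
  modulus rho a b f delta <= M.
Proof.
move=> ab delta0 fM; apply: ge_sup => [|_ [x [y [xab yab xy ->]]]]; last first.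
  exact: fM.
have aab : a \in `[a, b] by rewrite in_itv /= lexx.
by exists (rho (f a) (f a)), a, a; split=> //; rewrite subrr normr0.
Qed.

(** The bound [M] on all distances is what makes the supremum a true upper
bound. *)
Lemma le_modulus {M x y : R} :
  (forall x' y', x' \in `[a, b] -> y' \in `[a, b] -> rho (f x') (f y') <= M) ->
  x \in `[a, b] -> y \in `[a, b] -> `|x - y| <= delta ->
  rho (f x) (f y) <= modulus rho a b f delta.
Proof.
move=> fM xab yab xy; apply: ub_le_sup; last by exists x, y.
by exists M => _ [x' [y' [x'ab y'ab _ ->]]]; exact: fM.
Qed.

End Modulus.

(** By the triangle inequality [x |-> haus (F a) (F x)] is continuous, so it is
bounded on the segment, and [haus (F x) (F y)] is at most twice its maximum. *)
Lemma haus_continuous_bounded {R : realType} {n : nat} {a b : R}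
    {F : R -> set 'rV[R]_n} : a <= b ->
  (forall x, x \in `[a, b] -> nonempty_compact (F x)) ->
  haus_continuous a b F ->
  exists M, forall x y, x \in `[a, b] -> y \in `[a, b] -> haus (F x) (F y) <= M.
Proof.
move=> ab hF cF; have aab : a \in `[a, b] by rewrite in_itv /= lexx.
have cg : {within `[a, b], continuous (fun x => haus (F a) (F x))}.
  apply/subspace_continuousP => x /= xab; apply/cvgrPdist_lt => e e0.
  have [d d0 xd] := cF _ xab _ e0.
  rewrite near_withinE; near=> y => /= yab.
  have hxy : haus (F x) (F y) < e.
    by apply: xd => //; near: y; exact: cvgr_dist_lt.
  have := hausD (hF _ aab) (hF _ xab) (hF _ yab).
  have := hausD (hF _ aab) (hF _ yab) (hF _ xab).
  rewrite (hausC (F y) (F x)) => yx xy.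
  apply: le_lt_trans hxy; rewrite ler_norml; apply/andP; split.
    by rewrite lerNl opprB lerBlDl.
  by rewrite lerBlDl.
have [c cab cmax] := EVT_max ab cg.
exists (haus (F a) (F c) + haus (F a) (F c)) => x y xab yab.
have := hausD (hF _ xab) (hF _ aab) (hF _ yab).
have := cmax _ xab; have := cmax _ yab.
by rewrite (hausC (F x) (F a)); lra.
Unshelve. all: by end_near. Qed.

(** * Piecewise linear interpolation at the integers *)

Section Ramp.
Context {R : realType}.
Implicit Types t : R.

Definition ramp t : R := Num.max 0 (Num.min 1 t).

Lemma ramp_le0 {t} : t <= 0 -> ramp t = 0.
Proof. by move=> t0; rewrite /ramp min_r ?max_l//; lra. Qed.

Lemma ramp_ge1 {t} : 1 <= t -> ramp t = 1.
Proof. by move=> t1; rewrite /ramp min_l ?max_r. Qed.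

Lemma ramp_id {t} : 0 <= t <= 1 -> ramp t = t.
Proof. by move=> /andP[t0 t1]; rewrite /ramp min_r ?max_r. Qed.

Lemma ramp_le t t' : t <= t' -> ramp t <= ramp t'.
Proof.
move=> tt'; have [t0|t0] := leP t 0; first by rewrite (ramp_le0 t0) le_max lexx.
have [t1|t1] := leP 1 t'; first by rewrite (ramp_ge1 t1) ge_max ler01 ge_min lexx.
by rewrite !ramp_id//; lra.
Qed.

Lemma ramp_continuous : continuous ramp.
Proof.
move=> t; apply: (@continuous_max _ _ (fun=> 0 : R)); first exact: cst_continuous.
by apply: (@continuous_min _ _ (fun=> 1 : R)); first exact: cst_continuous.
Qed.

(** The ramps partition the length of the segment from [0] to [t] among the unit
cells; for [t <= M] the sum is [t] itself, which is what turns a bound on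
increments into a Lipschitz bound. *)
Lemma sum_ramp M t : 0 <= t -> \sum_(i < M) ramp (t - i%:R) = Num.min t M%:R.
Proof.
move=> t0; elim: M => [|M IH]; first by rewrite big_ord0 min_r.
rewrite big_ord_recr /= IH -natr1.
have [tM|Mt] := leP t M%:R.
  by rewrite ramp_le0 ?subr_le0// addr0 min_l//; lra.
have [tM1|M1t] := leP t (M%:R + 1).
  by rewrite ramp_id; lra.
by rewrite ramp_ge1; lra.
Qed.

End Ramp.

Section Polyline.
Context {R : realType} {n : nat} (w : nat -> 'rV[R]_n).
Implicit Types (M k : nat) (t : R).

(** The interpolant of [w 0, ..., w M] written as a sum of ramps instead of
cell by cell: continuity is immediate, and no cell has to be chosen for an argument. *)
Definition polyline M t : 'rV[R]_n :=
  w 0%N + \sum_(i < M) ramp (t - i%:R) *: (w i.+1 - w i).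

Lemma polylineS M t :
  polyline M.+1 t = polyline M t + ramp (t - M%:R) *: (w M.+1 - w M).
Proof. by rewrite /polyline big_ord_recr /= addrA. Qed.

Lemma polyline_end {M t} : M%:R <= t -> polyline M t = w M.
Proof.
elim: M => [_|M IH]; first by rewrite /polyline big_ord0 addr0.
rewrite -natr1 => Mt; have M1t : 1 <= t - M%:R by lra.
by rewrite polylineS IH ?ramp_ge1 ?scale1r ?(addrC (w M)) ?subrK//; lra.
Qed.

Lemma polyline_trunc {k M t} : (k <= M)%N -> t <= k%:R ->
  polyline M t = polyline k t.
Proof.
move=> kM tk; elim: M kM => [|M IH]; first by rewrite leqn0 => /eqP ->.
rewrite leq_eqVlt => /predU1P[-> //|]; rewrite ltnS => kM.
have kMR : k%:R <= M%:R :> R by rewrite ler_nat.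
rewrite polylineS IH// ramp_le0 ?scale0r ?addr0// subr_le0.
exact: le_trans kMR.
Qed.

Lemma polyline_cell {k M t} : (k < M)%N -> k%:R <= t <= k.+1%:R ->
  polyline M t = w k + (t - k%:R) *: (w k.+1 - w k).
Proof.
move=> kM /andP[kt tk]; rewrite (polyline_trunc kM tk) polylineS polyline_end//.
by rewrite ramp_id//; move: tk; rewrite -natr1; lra.
Qed.

Lemma polyline_node {k M} : (k <= M)%N -> polyline M k%:R = w k.
Proof. by move=> kM; rewrite (polyline_trunc kM)// polyline_end. Qed.

Lemma polyline_continuous M : continuous (polyline M).
Proof.
have sumc : continuous (fun t => \sum_(i < M) ramp (t - i%:R) *: (w i.+1 - w i)).
  apply: sum_continuous => i.
  have shiftc : continuous (fun t : R => t - i%:R).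
    move=> t; apply: cvgB; first exact: cvg_id.
    exact: cvg_cst.
  move=> t; apply: cvgZr_tmp.
  exact: (continuous_comp (shiftc t) (@ramp_continuous R _)).
by move=> t; apply: cvgD; [exact: cvg_cst|exact: sumc].
Qed.

(** Every ramp is monotone, so the absolute values of their increments between [t]
and [t'] add up to [`|t - t'|], whatever cells [t] and [t'] are in. *)
Lemma polyline_lipschitz {M} {L t t' : R} :
  (forall i, (i < M)%N -> eucl_dist (w i) (w i.+1) <= L) ->
  0 <= t <= M%:R -> 0 <= t' <= M%:R ->
  eucl_dist (polyline M t) (polyline M t') <= L * `|t - t'|.
Proof.
move=> wL; wlog tt' : t t' / t' <= t.
  move=> main tM t'M; have [|/ltW] := leP t' t; first by move/main; exact.
  by rewrite eucl_distC distrC => /main; exact.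
move=> /andP[t0 tM] /andP[t'0 t'M]; rewrite ger0_norm ?subr_ge0//.
have -> : L * (t - t') = \sum_(i < M) (ramp (t - i%:R) - ramp (t' - i%:R)) * L.
  by rewrite -mulr_suml sumrB !sum_ramp// !min_l// mulrC.
rewrite /eucl_dist /polyline opprD addrACA subrr add0r -sumrB.
apply: le_trans (eucl_norm_sum _) _; apply: ler_sum => i _.
rewrite -scalerBl eucl_normZ ger0_norm ?subr_ge0; last by apply: ramp_le; lra.
apply: ler_wpM2l; first by rewrite subr_ge0; apply: ramp_le; lra.
by rewrite -[eucl_norm _]/(eucl_dist _ _) eucl_distC wL.
Qed.

End Polyline.

(** * Metric chains *)

Section Chains.
Context {R : realType} {n N : nat} {A : 'I_N.+1 -> set 'rV[R]_n}.
Context (cptA : forall i, nonempty_compact (A i)).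

Lemma metric_chain_haus {v} {i k : 'I_N.+1} : metric_chain A v ->
  k = i.+1 :> nat -> eucl_dist (v i) (v k) <= haus (A i) (A k).
Proof.
move=> [Av [j hj]] ki; have [back forth] := hj _ _ ki.
have [kj|jk] := leqP k j.
  have [_ vk] := back kj.
  by rewrite eucl_distC vk hausC; exact: dist_set_le_haus.
have [_ ->] : proj_set (A k) (v i) (v k) by apply: forth; rewrite -ltnS -ki.
exact: dist_set_le_haus.
Qed.

(** Starting from [p] in [A j], project successively onto [A j.+1], [A j.+2], ...
and onto [A j.-1], [A j.-2], ... *)
Lemma metric_chain_through {j p} : A j p ->
  exists2 v, metric_chain A v & v j = p.
Proof.
move=> Ajp.
pose pr i u := xget u (proj_set (A i) u).
have prP i u : proj_set (A i) u (pr i u).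
  exact: xgetPex (proj_set_nonempty u (cptA i)).
pose fwd := fix fwd m := if m is m'.+1 then pr (inord (j + m)) (fwd m') else p.
pose bwd := fix bwd m := if m is m'.+1 then pr (inord (j - m)) (bwd m') else p.
pose v (i : 'I_N.+1) := if (i <= j)%N then bwd (j - i)%N else fwd (i - j)%N.
have fwdE (i : 'I_N.+1) : (j <= i)%N -> v i = fwd (i - j)%N.
  rewrite /v leq_eqVlt => /predU1P[->|]; first by rewrite leqnn subnn.
  by rewrite ltnNge => /negbTE ->.
have bwdE (i : 'I_N.+1) : (i <= j)%N -> v i = bwd (j - i)%N by rewrite /v => ->.
have vj : v j = p by rewrite fwdE// subnn.
have chain (i k : 'I_N.+1) : k = i.+1 :> nat ->
    ((k <= j)%N -> proj_set (A i) (v k) (v i)) /\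
    ((j <= i)%N -> proj_set (A k) (v i) (v k)).
  move=> ki; split=> [kj|ji].
    have ij : (i < j)%N by rewrite -ki.
    rewrite (bwdE k)// bwdE 1?ltnW// ki -(subnSK ij) /= subnSK// subKn 1?ltnW//.
    by rewrite inord_val.
  rewrite (fwdE i)// fwdE ?ki 1?leqW// subSn//=.
  by rewrite addnS subnKC// -ki inord_val.
exists v => //; split; last by exists j.
move=> i; have [ij|ji|/val_inj ->] := ltngtP i j; last by rewrite vj.
- have iN : (i.+1 < N.+1)%N by exact: leq_ltn_trans ij (ltn_ord j).
  by have [/(_ ij) []] := chain i (Ordinal iN) erefl.
- have iN : (i.-1 < N.+1)%N by exact: leq_ltn_trans (leq_pred i) (ltn_ord i).
  have i0 : (0 < i)%N by exact: leq_ltn_trans ji.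
  have [_ ] := chain (Ordinal iN) i (esym (prednK i0)).
  by rewrite /= -ltnS prednK// => /(_ ji) [].
Qed.

End Chains.

(** * Splines on the uniform grid *)

(** The affine coordinate sending the nodes to [0, ..., N]. *)
Definition grid_coord {R : realType} (N : nat) (a b x : R) : R :=
  (x - a) / step N a b.

Section Grid.
Context {R : realType} {N : nat} {a b : R}.
Context (hN : (1 <= N)%N) (hab : a < b).
Local Notation h := (step N a b).
Local Notation tau := (grid_coord N a b).

Let N_gt0 : 0 < N%:R :> R. Proof. by rewrite ltr0n. Qed.

Lemma step_gt0 : 0 < h.
Proof. by rewrite /step divr_gt0// subr_gt0. Qed.

Let h_neq0 : h != 0. Proof. exact: lt0r_neq0 step_gt0. Qed.

Lemma grid_coordB x y : tau x - tau y = (x - y) / h.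
Proof. by rewrite /grid_coord -mulrBl opprB addrA subrK. Qed.

Lemma grid_coord_node i : tau (node N a b i) = i%:R.
Proof. by rewrite /grid_coord /node addrC addKr mulfK. Qed.

Lemma grid_coord_ge i x : (i%:R <= tau x) = (node N a b i <= x).
Proof.
rewrite -[_%:R]grid_coord_node -subr_ge0 grid_coordB.
by rewrite pmulr_lge0 ?invr_gt0 ?step_gt0// subr_ge0.
Qed.

Lemma grid_coord_le i x : (tau x <= i%:R) = (x <= node N a b i).
Proof.
rewrite -[i%:R]grid_coord_node -subr_ge0 grid_coordB.
by rewrite pmulr_lge0 ?invr_gt0 ?step_gt0// subr_ge0.
Qed.

Lemma node0 : node N a b 0 = a.
Proof. by rewrite /node mul0r addr0. Qed.

Lemma nodeN : node N a b N = b.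
Proof. by rewrite /node /step mulrC divfK ?lt0r_neq0// addrC subrK. Qed.

Lemma grid_coord_itv {x} : x \in `[a, b] -> 0 <= tau x <= N%:R.
Proof.
by rewrite in_itv /= (grid_coord_ge 0) grid_coord_le node0 nodeN.
Qed.

Lemma node_itv i : (i <= N)%N -> node N a b i \in `[a, b].
Proof.
move=> iN; rewrite in_itv /=; apply/andP; split.
  by rewrite -[X in X <= _]node0 -grid_coord_ge grid_coord_node ler0n.
by rewrite -[X in _ <= X]nodeN -grid_coord_le grid_coord_node ler_nat.
Qed.

Lemma node_near {x} : x \in `[a, b] ->
  exists i : 'I_N.+1, `|x - node N a b i| <= h.
Proof.
move=> /grid_coord_itv /andP[x0 xN].
have /andP[ix xi] := truncn_itv x0.
have iN : (Num.truncn (tau x) < N.+1)%N.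
  by rewrite ltnS -(ler_nat R); exact: le_trans xN.
exists (Ordinal iN) => /=; set i := Num.truncn _ in ix xi *.
have : 0 <= (x - node N a b i) / h <= 1.
  by rewrite -grid_coordB grid_coord_node; move: xi; rewrite -natr1; lra.
rewrite pmulr_lge0 ?invr_gt0 ?step_gt0// ler_pdivrMr ?step_gt0// mul1r.
by move=> /andP[? ?]; rewrite ger0_norm.
Qed.

Lemma spline_polyline {n} (w : nat -> 'rV[R]_n) :
  spline N a b (fun x => polyline w N (tau x)).
Proof.
split.
  apply: continuous_subspaceT => x.
  have gc : {for x, continuous tau}.
    apply: cvgMr_tmp; apply: cvgB; [exact: cvg_id|exact: cvg_cst].
  exact: (continuous_comp gc (polyline_continuous w N (tau x))).
move=> i; pose d : 'rV[R]_n := w i.+1 - w i.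
exists (w i - (a / h + i%:R) *: d), (h^-1 *: d) => x.
rewrite in_itv /= -grid_coord_ge -grid_coord_le => xi.
rewrite (polyline_cell w (ltn_ord i) xi) -/d -addrA scalerA -scaleNr -scalerDl.
by congr (_ + _ *: _); rewrite /grid_coord mulrBl; ring.
Qed.

Lemma spline_line {n} (u : 'rV[R]_n) : spline N a b (fun x => x *: u).
Proof.
split; last by move=> i; exists 0, u => x _; rewrite add0r.
by apply: continuous_subspaceT => x; apply: cvgZr_tmp; exact: cvg_id.
Qed.

End Grid.

(** * The error estimate *)

Section ErrorBound.
Context {R : realType} {n N : nat} {a b : R}.
Context (hN : (1 <= N)%N) (hab : a < b).
Local Notation h := (step N a b).
Local Notation tau := (grid_coord N a b).

Let ab := ltW hab.
Let a_itv : a \in `[a, b]. Proof. by rewrite in_itv /= lexx. Qed.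

Lemma polyline_modulus {w : nat -> 'rV[R]_n} {L : R} :
  0 <= L -> (forall i, (i < N)%N -> eucl_dist (w i) (w i.+1) <= L) ->
  0 <= modulus (@eucl_dist R n) a b
         (fun x => polyline w N (tau x)) h <= L.
Proof.
move=> L0 wL; have h0 := step_gt0 hN hab.
have lip x y : x \in `[a, b] -> y \in `[a, b] ->
    eucl_dist (polyline w N (tau x))
              (polyline w N (tau y)) <= L * (`|x - y| / h).
  move=> xab yab; have := polyline_lipschitz w wL (grid_coord_itv hN hab xab)
    (grid_coord_itv hN hab yab).
  by rewrite grid_coordB normrM [`|h^-1|]gtr0_norm ?invr_gt0.
apply/andP; split.
  rewrite -[X in X <= _](eucl_distxx (polyline w N (tau a))).
  apply: (@le_modulus _ _ _ _ _ (fun x => polyline w N (tau x)) _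
            (L * ((b - a) / h))) => //; last first.
    by rewrite subrr normr0 ltW.
  move=> x y xab yab; apply: le_trans (lip _ _ xab yab) _.
  apply: ler_wpM2l => //; apply: ler_wpM2r; first by rewrite invr_ge0 ltW.
  by move: xab yab; rewrite !in_itv /= ler_norml; lra.
apply: modulus_le => // [|x y xab yab xy]; first exact: ltW.
apply: le_trans (lip _ _ xab yab) _.
by rewrite ler_piMr// ler_pdivrMr// mul1r.
Qed.

(** Only [C < 0] is at stake.  The bound then gives [psi m = 0] at the modulus [m]
of every spline; a linear spline along [u] has modulus at least [t'], so [psi t' = 0]
by monotonicity. *)
Lemma error_bound_monotone {C : R} {psi : R -> R} :
  (forall t, 0 <= t -> 0 <= psi t) ->
  (forall t t', 0 <= t -> t <= t' -> psi t <= psi t') ->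
  (forall s : R -> 'rV[R]_n, spline N a b s ->
     0 <= C * psi (modulus (@eucl_dist R n) a b s h)) ->
  (exists u : 'rV[R]_n, 0 < eucl_norm u) ->
  forall t t', 0 <= t -> t <= t' -> C * psi t <= C * psi t'.
Proof.
move=> psi_ge0 psi_ndecr bound_ge0 [u u0] t t' t0 tt'.
have [C0|C0] := leP 0 C; first by apply: ler_wpM2l => //; exact: psi_ndecr.
have h0 := step_gt0 hN hab; have t'0 : 0 <= t' by exact: le_trans tt'.
have t'_mod : t' <= modulus (@eucl_dist R n) a b
                      (fun x => x *: ((t' / (h * eucl_norm u)) *: u)) h.
  (* the slope is scaled so that one step of length [h] moves by [t'] *)
  set p := _ *: u.
  have pE : eucl_norm p = t' / h.
    rewrite eucl_normZ ger0_norm; last by rewrite divr_ge0// ltW// mulr_gt0.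
    by field; rewrite !lt0r_neq0.
  have lineE x y : eucl_dist (x *: p) (y *: p) = `|x - y| * (t' / h).
    by rewrite /eucl_dist -scalerBl eucl_normZ pE.
  have -> : t' = eucl_dist (node N a b 1 *: p) (node N a b 0 *: p).
    rewrite lineE node0 /node mul1r addrC addKr gtr0_norm// mulrC divfK//.
    exact: lt0r_neq0.
  apply: (@le_modulus _ _ _ _ _ (fun x => x *: p) _ ((b - a) * (t' / h))).
  - move=> x y xab yab; rewrite lineE.
    apply: ler_wpM2r; first by rewrite divr_ge0// ltW.
    by move: xab yab; rewrite !in_itv /= ler_norml; lra.
  - exact: node_itv.
  - exact: node_itv.
  - by rewrite node0 /node mul1r addrC addKr gtr0_norm.
have := bound_ge0 _ (spline_line ((t' / (h * eucl_norm u)) *: u)).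
rewrite nmulr_rge0// => mod_le0.
have psit' : psi t' = 0.
  apply/eqP; rewrite eq_le psi_ge0// andbT.
  exact: le_trans (psi_ndecr _ _ t'0 t'_mod) mod_le0.
by rewrite psit' mulr0 nmulr_rle0// psi_ge0.
Qed.

End ErrorBound.

Theorem theorem5p4 (R : realType) (n N : nat) (a b : R)
  (hN : (1 <= N)%N) (hab : a < b)
  (C : R) (phi : R -> R -> R)
  (phi_ge0 : forall x t : R, x \in `[a, b] -> 0 <= t -> 0 <= phi x t)
  (phi_cont : {within [set p : R * R | p.1 \in `[a, b] /\ 0 <= p.2],
                 continuous (fun p : R * R => phi p.1 p.2)})
  (phi_ndecr : forall x t t' : R, x \in `[a, b] -> 0 <= t -> t <= t' ->
                 phi x t <= phi x t')
  (phi0 : forall x : R, x \in `[a, b] -> phi x 0 = 0)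
  (c : 'I_N.+1 -> R -> R)
  (approx : forall s : R -> 'rV[R]_n, spline N a b s ->
     forall x : R, x \in `[a, b] ->
     eucl_norm (sample_op a b c s x - s x)
       <= C * phi x (modulus (@eucl_dist R n) a b s (step N a b))) :
  forall F : R -> set 'rV[R]_n,
    (forall x : R, x \in `[a, b] -> nonempty_compact (F x)) ->
    haus_continuous a b F ->
    forall x : R, x \in `[a, b] ->
    haus (metric_sample_op a b c F x) (F x)
      <= 2 * modulus (@haus R n) a b F (step N a b)
         + C * phi x (4 * modulus (@haus R n) a b F (step N a b)).
Proof.
move=> F hF cF x xab; set h := step N a b; set w := modulus _ a b F h.
have h0 : 0 < h := step_gt0 hN hab.
have ab := ltW hab.
have [M FM] := haus_continuous_bounded ab hF cF.
have Fw y z : y \in `[a, b] -> z \in `[a, b] -> `|y - z| <= h ->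
    haus (F y) (F z) <= w by exact: le_modulus FM.
have w0 : 0 <= w.
  apply: le_trans (haus_ge0 (hF _ xab) (hF _ xab)) _.
  by apply: Fw => //; rewrite subrr normr0 ltW.
have nodeP (i : 'I_N.+1) : node N a b i \in `[a, b].
  by apply: node_itv => //; exact: leq_ord.
have hFn (i : 'I_N.+1) : nonempty_compact (F (node N a b i)) by exact: hF.
have Cphi t : 0 <= t <= w -> C * phi x t <= C * phi x (4 * w).
  move=> /andP[t0 tw].
  have [u0|u0] := pselect (exists u : 'rV[R]_n, 0 < eucl_norm u).
    apply: (error_bound_monotone hN hab _ _ _ u0) => //; last by lra.
    - by move=> ?; exact: phi_ge0.
    - by move=> ? ?; exact: phi_ndecr.
    - by move=> s /approx /(_ _ xab); apply: le_trans; exact: eucl_norm_ge0.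
  (* without a vector of positive norm the space is a point and [w = 0] *)
  suff w_le0 : w <= 0.
    have -> : t = 0 by apply/eqP; rewrite eq_le t0 (le_trans tw).
    by rewrite (_ : w = 0) ?mulr0//; apply/eqP; rewrite eq_le w_le0.
  have dist_le0 (p q : 'rV[R]_n) : eucl_dist p q <= 0.
    by rewrite leNgt; apply/negP => pq; apply: u0; exists (p - q).
  have dist_set_le0 (p : 'rV[R]_n) B : B !=set0 -> dist_set p B <= 0.
    by move=> [q Bq]; apply: le_trans (dist_set_le Bq) _; exact: dist_le0.
  apply: modulus_le => // [|y z yab zab _]; first exact: ltW.
  have Fy := (hF _ yab).1; have Fz := (hF _ zab).1.
  by apply: haus_le => // p _; exact: dist_set_le0.
have key v (i : 'I_N.+1) : metric_chain (fun i => F (node N a b i)) v ->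
    `|x - node N a b i| <= h ->
    eucl_dist (\sum_(k < N.+1) c k x *: v k) (v i) <= w + C * phi x (4 * w).
  move=> vF xi; pose u k := v (inord k).
  pose s y := polyline u N (grid_coord N a b y).
  have uw k : (k < N)%N -> eucl_dist (u k) (u k.+1) <= w.
    move=> kN; have kN1 := ltnW kN.
    have := metric_chain_haus hFn vF (_ : inord k.+1 = (inord k).+1 :> nat).
    rewrite !inordK// => /(_ erefl) /le_trans; apply.
    apply: Fw; rewrite ?node_itv// distrC /node opprD addrACA subrr add0r.
    by rewrite -mulrBl -natr1 addrC addKr mul1r gtr0_norm.
  have sv (k : 'I_N.+1) : s (node N a b k) = v k.
    by rewrite /s grid_coord_node// polyline_node ?leq_ord// /u inord_val.
  have /Cphi err := polyline_modulus hN hab w0 uw.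
  have := approx s (spline_polyline hN hab u) _ xab.
  have -> : sample_op a b c s x = \sum_(k < N.+1) c k x *: v k.
    by apply: eq_bigr => k _; rewrite sv.
  move=> /le_trans /(_ err) As.
  apply: le_trans (eucl_distD (s x) _ _) _; rewrite addrC lerD// -sv.
  have := polyline_lipschitz u uw (grid_coord_itv hN hab xab)
    (grid_coord_itv hN hab (nodeP i)).
  move=> /le_trans; apply; rewrite ler_piMr// grid_coordB normrM.
  by rewrite [`|_^-1|]gtr0_norm ?invr_gt0// ler_pdivrMr// mul1r.
have [i xi] := node_near hN hab xab.
have chain_at p : F (node N a b i) p ->
    exists2 v, metric_chain (fun i => F (node N a b i)) v & v i = p.
  exact: (metric_chain_through hFn).
have Fxi : haus (F x) (F (node N a b i)) <= w by exact: Fw.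
apply: haus_le => [| |_ [v vF <-]|y Fy].
- have [[p Fp] _] := hFn i; have [v vF _] := chain_at _ Fp.
  by exists (\sum_(k < N.+1) c k x *: v k), v.
- exact: (hF _ xab).1.
- apply: le_trans (dist_setD _ (v i) (hF _ xab)) _.
  have := dist_set_le_haus (hFn i) (hF _ xab) (vF.1 i).
  by have := key _ _ vF xi; rewrite hausC; lra.
- have [p [Fp yp]] := proj_set_nonempty y (hFn i).
  have [v vF vi] := chain_at _ Fp.
  apply: le_trans (dist_set_le _) _; first by exists v; [exact: vF|reflexivity].
  apply: le_trans (eucl_distD (v i) _ _) _.
  have := dist_set_le_haus (hF _ xab) (hFn i) Fy.
  by have := key _ _ vF xi; rewrite vi yp eucl_distC; lra.
Qed.
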